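(* Let $\mathcal{S}$ be a unipotent numerical monoid in $G$. Then $\mathcal{S}$ is irreducible if and only if the torsion monoid $Rel_T(\mathcal{S},\subseteq)$ has a unique minimal nontrivial idempotent and the two-sided Frobenius set of $\mathcal{S}$ equals the set of special gaps of $\mathcal{S}$, i.e. $\mathtt{F}_t(\mathcal{S})=\mathtt{SG}(\mathcal{S})$.
   Context: Setting: $n$ is a positive integer, $\mathbf{U}(n,\mathbb{C})$ is the group of upper triangular unipotent $n\times n$ complex matrices, and $G$ is a (Zariski) closed subgroup of it. $G_{\mathbb{Z}}$ is the group of matrices in $G$ with integer entries, and $G(\mathbb{N})$ is the monoid of matrices in $G_{\mathbb{Z}}$ all of whose entries lie in $\mathbb{N}=\{0,1,2,\dots\}$. Standing assumptions: the monoid $G(\mathbb{N})$ is finitely generated and $G_{\mathbb{Z}}$ is its group completion. $\mathbf{1}_n$ is the identity matrix; for $\mathcal{X}\subseteq G(\mathbb{N})$, $\mathcal{X}^*:=\mathcal{X}\setminus\{\mathbf{1}_n\}$; $\mathcal{X}\mathcal{Y}:=\{XY\mid X\in\mathcal{X},Y\in\mathcal{Y}\}$, $A\mathcal{X}:=\{AX\mid X\in\mathcal{X}\}$, and similarly $\mathcal{X}A$. A unipotent numerical monoid in $G$ is a finitely generated submonoid $\mathcal{S}\subseteq G(\mathbb{N})$ (containing $\mathbf{1}_n$) such that $G(\mathbb{N})\setminus\mathcal{S}$ is finite. $\mathcal{S}$ is irreducible if there are no two unipotent numerical monoids $\mathcal{T}_1,\mathcal{T}_2$ in $G$, each properly containing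 $\mathcal{S}$, with $\mathcal{T}_1\cap\mathcal{T}_2=\mathcal{S}$. A relative ideal of $\mathcal{S}$ is a subset $\mathcal{I}\subseteq G(\mathbb{N})$ with $\mathcal{I}\mathcal{S}\subseteq\mathcal{I}$ and $\mathcal{S}\mathcal{I}\subseteq\mathcal{I}$. The torsion monoid $Rel_T(\mathcal{S},\subseteq)$ is the monoid, under $(\mathcal{I},\mathcal{J})\mapsto\mathcal{I}\mathcal{J}$, of all relative ideals of $\mathcal{S}$ containing $\mathcal{S}$; its neutral element is $\mathcal{S}$, called the trivial idempotent. Idempotents are ordered by inclusion; a minimal nontrivial idempotent is one that is minimal among the idempotents different from $\mathcal{S}$. $\mathtt{F}_t(\mathcal{S}):=\{A\in G(\mathbb{N})\mid A\notin\mathcal{S},\ A\,G(\mathbb{N})^*\cup G(\mathbb{N})^*A\subseteq\mathcal{S}\}$ (two-sided Frobenius set); $\mathtt{PF}_t(\mathcal{S}):=\{A\in G(\mathbb{N})\mid A\notin\mathcal{S},\ A\mathcal{S}^*\cup\mathcal{S}^*A\subseteq\mathcal{S}\}$ (two-sided pseudo-Frobenius set); $\mathtt{SG}(\mathcal{S}):=\{A\in\mathtt{PF}_t(\mathcal{S})\mid A^2\in\mathcal{S}\}$ (set of special gaps).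
   Formalization: The formal theorem assumes in addition that S ≠ G(N); for S = G(N) the claim is false, since G(N) is vacuously irreducible while Rel_T(G(N)) = {G(N)} has no nontrivial idempotent. *)

(* Defs.v *)
From HB Require Import structures.
From mathcomp Require Import all_boot all_order all_algebra.
From mathcomp Require Import complex.
From mathcomp Require mpoly.
From mathcomp Require Import boolp classical_sets cardinality reals.

Set Implicit Arguments.
Unset Strict Implicit.
Unset Printing Implicit Defensive.

Import GRing.Theory.
Local Open Scope classical_set_scope.
Local Open Scope ring_scope.
Local Open Scope complex_scope.

(* The field of complex numbers is R[i], for R : realType. *)

Section Ambient.
Variables (R : realType) (n : nat).
Implicit Types (A B : 'M[R[i]]_n) (G M X Y : set 'M[R[i]]_n).

Definition unipotent_group : set 'M[R[i]]_n :=
  [set A | (forall i, A i i = 1) /\ (forall i j : 'I_n, (j < i)%N -> A i j = 0)].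

(* A polynomial in the n ^ 2 matrix entries is evaluated at A through the
   row-major enumeration mxvec of the entries of A. *)
Definition zero_locus (P : set (mpoly.mpoly (n * n) R[i])) :
    set 'M[R[i]]_n :=
  [set A | forall p, P p -> mpoly.meval (fun k => mxvec A 0 k) p = 0].

Definition submonoid M : Prop :=
  M 1%:M /\ (forall A B, M A -> M B -> M (A *m B)).

Definition subgroup M : Prop :=
  submonoid M /\ (forall A, M A -> M (invmx A)).

Definition closed_unipotent_subgroup G : Prop :=
  [/\ G `<=` unipotent_group, subgroup G
    & exists P, G = unipotent_group `&` zero_locus P].

Definition int_points G : set 'M[R[i]]_n :=
  G `&` [set A | forall i j, exists z : int, A i j = z%:~R].

Definition nat_points G : set 'M[R[i]]_n :=
  int_points G `&` [set A | forall i j, exists k : nat, A i j = k%:R].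

Definition finitely_generated M : Prop :=
  exists X, finite_set X /\ M = smallest submonoid X.

Definition monoid_morphism_on M (H : groupType) (f : 'M[R[i]]_n -> H) : Prop :=
  f 1%:M = 1%g /\
  (forall A B, M A -> M B -> f (A *m B) = (f A * f B)%g).

(* Universal property of the inclusion of the monoid M in the group K; maps
   are total functions, of which only the values on M or on K matter. *)
Definition group_completion M K : Prop :=
  [/\ subgroup K, M `<=` K
    & forall (H : groupType) (f : 'M[R[i]]_n -> H), monoid_morphism_on M f ->
      exists g : 'M[R[i]]_n -> H,
        [/\ monoid_morphism_on K g, (forall A, M A -> g A = f A)
          & forall g' : 'M[R[i]]_n -> H, monoid_morphism_on K g' ->
              (forall A, M A -> g' A = f A) -> forall A, K A -> g' A = g A]].

Definition setmulmx X Y : set 'M[R[i]]_n := [set A *m B | A in X & B in Y].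

Definition star X : set 'M[R[i]]_n := X `\ 1%:M.

End Ambient.

Section NumericalMonoids.
Variables (R : realType) (n : nat) (G : set 'M[R[i]]_n).
Implicit Types (S T I J : set 'M[R[i]]_n).

Definition unipotent_numerical_monoid S : Prop :=
  [/\ S `<=` nat_points G, submonoid S, finitely_generated S
    & finite_set (nat_points G `\` S)].

Definition irreducible S : Prop :=
  ~ exists T1 T2,
      [/\ unipotent_numerical_monoid T1, unipotent_numerical_monoid T2,
          S `<` T1, S `<` T2 & T1 `&` T2 = S].

Definition relative_ideal S I : Prop :=
  [/\ I `<=` nat_points G, setmulmx I S `<=` I & setmulmx S I `<=` I].

(* The carrier of the torsion monoid; its product is setmulmx and its neutral
   element is S, see torsion_monoid_mul, torsion_monoid_1 and the unit laws. *)
Definition torsion_monoid S : set (set 'M[R[i]]_n) :=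
  [set I | relative_ideal S I /\ S `<=` I].

Definition torsion_idempotent S I : Prop :=
  torsion_monoid S I /\ setmulmx I I = I.

Definition minimal_nontrivial_idempotent S I : Prop :=
  [/\ torsion_idempotent S I, I <> S
    & forall J, torsion_idempotent S J -> J <> S -> J `<=` I -> J = I].

Definition Frobenius_set S : set 'M[R[i]]_n :=
  [set A | [/\ nat_points G A, ~ S A
    & [set A *m B | B in star (nat_points G)] `|`
      [set B *m A | B in star (nat_points G)] `<=` S]].

Definition pseudo_Frobenius_set S : set 'M[R[i]]_n :=
  [set A | [/\ nat_points G A, ~ S A
    & [set A *m B | B in star S] `|` [set B *m A | B in star S] `<=` S]].

Definition special_gaps S : set 'M[R[i]]_n :=
  [set A | pseudo_Frobenius_set S A /\ S (A *m A)].

Lemma submonoid_nat_points : subgroup G -> submonoid (nat_points G).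
Proof.
move=> [[G1 GM] _]; split.
  split; first split=> //.
    by move=> i j; exists (i == j)%:Z; rewrite mxE.
  by move=> i j; exists (i == j); rewrite mxE.
move=> A B [[GA _] NA] [[GB _] NB].
have NAB i j : exists k : nat, (A *m B) i j = k%:R.
  rewrite mxE; elim/big_ind: _ => [|_ _ [a ->] [b ->]|k _]; first by exists 0%N.
    by exists (a + b)%N; rewrite natrD.
  have [a ->] := NA i k; have [b ->] := NB k j.
  by exists (a * b)%N; rewrite natrM.
by split=> //; split=> [|i j]; [exact: GM | have [k ->] := NAB i j; exists k].
Qed.

Lemma torsion_monoid_mul S I J : subgroup G -> submonoid S ->
  torsion_monoid S I -> torsion_monoid S J -> torsion_monoid S (setmulmx I J).
Proof.
move=> /submonoid_nat_points[_ NM] [S1 _].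
move=> [[IN IS SI] leSI] [[JN JS SJ] leSJ]; split; [split|].
- by move=> _ [A IA [B JB <-]]; apply: NM; [exact: IN|exact: JN].
- move=> _ [_ [A IA [B JB <-]] [C SC <-]]; rewrite -mulmxA.
  by exists A => //; exists (B *m C) => //; apply: JS; exists B => //; exists C.
- move=> _ [C SC [_ [A IA [B JB <-]] <-]]; rewrite mulmxA.
  by exists (C *m A); [apply: SI; exists C => //; exists A | exists B].
- by move=> A SA; exists A; [exact: leSI | exists 1%:M; [exact: leSJ | rewrite mulmx1]].
Qed.

Lemma torsion_monoid_1 S :
  S `<=` nat_points G -> submonoid S -> torsion_monoid S S.
Proof.
by move=> SN [_ SM]; split=> //; split=> // _ [A SA [B SB <-]]; apply: SM.
Qed.

Lemma torsion_monoid_mul1 S I :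
  submonoid S -> torsion_monoid S I -> setmulmx I S = I.
Proof.
move=> [S1 _] [[_ IS _] _]; apply/seteqP; split=> // A IA.
by exists A => //; exists 1%:M => //; rewrite mulmx1.
Qed.

Lemma torsion_monoid_1mul S I :
  submonoid S -> torsion_monoid S I -> setmulmx S I = I.
Proof.
move=> [S1 _] [[_ _ SI] _]; apply/seteqP; split=> // A IA.
by exists 1%:M => //; exists A => //; rewrite mul1mx.
Qed.

End NumericalMonoids.

(* Main.v *)
(** The idempotents of the torsion monoid of S are exactly the unipotent
    numerical monoids containing S, and each nontrivial one contains a minimal
    one because S has finitely many gaps.  Since these monoids are stable under
    intersection, S is irreducible iff there is only one minimal nontrivial
    idempotent.  It remains to see that an irreducible S satisfies F_t = SG.
    The inclusion of F_t in SG always holds.  Adjoining to S a special gap gives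
    a numerical monoid, so that an irreducible S has at most one special gap;
    and F_t is not empty, because it contains any gap that is maximal for the
    entrywise order. *)

Require Import Defs.
From HB Require Import structures.
From mathcomp Require Import all_boot all_order all_algebra.
From mathcomp Require Import complex finmap.
From mathcomp Require mpoly.
From mathcomp Require Import boolp classical_sets cardinality reals.

Local Open Scope classical_set_scope.
Local Open Scope ring_scope.
Local Open Scope complex_scope.

Import Order.TTheory GRing.Theory Num.Theory.

(** Induction on a list: a maximal [x] of the tail is replaced by the head [a] exactly when
    [le x a]. As [le] is merely transitive, maximality of [x] reads [le x y -> le y x]. *)
Lemma finite_set_maximal (T : eqType) (le : T -> T -> Prop) (X : set T) :
  (forall y x z, le x y -> le y z -> le x z) ->
  finite_set X -> X !=set0 ->
  exists x, X x /\ forall y, X y -> le x y -> le y x.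
Proof.
move=> trans /finite_seqP[s ->].
elim: s => [|a s IHs] [x0 /=]; first by rewrite in_nil.
move=> _; have [s0|s_neq0] := eqVneq s [::].
  exists a; split; first by rewrite /= mem_head.
  by move=> y; rewrite /= s0 inE => /eqP ->.
have [|x [/= sx xmax]] := IHs.
  by case: {IHs} s s_neq0 => // b s _; exists b; rewrite /= mem_head.
have [le_xa|nle_xa] := pselect (le x a); last first.
  exists x; split; first by rewrite /= inE sx orbT.
  by move=> y /=; rewrite inE => /orP[/eqP -> //|]; apply: xmax.
exists a; split; first by rewrite /= mem_head.
move=> y /=; rewrite inE => /orP[/eqP -> //|sy] le_ay.
by apply: (trans x y a _ le_xa); apply: xmax => //; exact: trans le_xa le_ay.
Qed.

(** Descent on the cardinality of [I \ S]: since sets with [P] contain [S], one strictly inside [I]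
    has strictly fewer elements outside [S]. *)
Lemma cofinite_minimal (T : choiceType) (S I : set T) (P : set T -> Prop) :
  (forall J, P J -> S `<=` J) -> finite_set (I `\` S) -> P I ->
  exists J, [/\ P J, J `<=` I & forall K, P K -> K `<=` J -> K = J].
Proof.
move=> PS; have [m] := ubnP #|` fset_set (I `\` S)|.
elim: m I => // m IHm I; rewrite ltnS => leIm finI PI.
have [Imin|] := pselect (forall K, P K -> K `<=` I -> K = I).
  by exists I; split.
move=> /existsNP[K /not_implyP[PK /not_implyP[leKI /eqP neqKI]]].
have finK : finite_set (K `\` S) by apply: sub_finite_set finI; apply: setSD.
have [|//|//|J [PJ leJK Jmin]] := IHm K.
  apply: leq_trans leIm; apply: fproper_ltn_card.
  rewrite fproperEneq; apply/andP; split; last first.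
    by rewrite -fset_set_sub //; apply: setSD.
  apply: contra_neq neqKI => eqKI; apply/seteqP; split=> // A IA.
  have [SA|nSA] := pselect (S A); first exact: (PS K).
  have : (I `\` S) A by [].
  by rewrite -(fset_setK finI) -eqKI fset_setK // => -[].
by exists J; split=> //; apply: subset_trans leJK leKI.
Qed.

Section Monoids.
Set Implicit Arguments.
Unset Strict Implicit.
Variables (R : realType) (n : nat) (G : set 'M[R[i]]_n).
Hypothesis G_closed : closed_unipotent_subgroup G.
Implicit Types (A B : 'M[R[i]]_n) (S T I : set 'M[R[i]]_n).

Lemma nat_points_unipotent A : nat_points G A -> unipotent_group A.
Proof. by case: G_closed => GU _ _ [[/GU]]. Qed.

Lemma nat_points_ge0 A i j : nat_points G A -> 0 <= A i j.
Proof. by move=> [_ /(_ i j)[k ->]]; apply: ler0n. Qed.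

(** The diagonals being 1, the indices [i] and [j] contribute [B i j] and [A i j] to the sum; the
    other terms are nonnegative. *)
Lemma mulmx_entry_ge A B (i j : 'I_n) : nat_points G A -> nat_points G B ->
  (i < j)%N -> A i j + B i j <= (A *m B) i j.
Proof.
move=> NA NB ij; rewrite mxE (bigD1 i) //= (bigD1 j) /=; last first.
  by rewrite -val_eqE /= gtn_eqF.
have [[-> _] [-> _]] := (nat_points_unipotent NA, nat_points_unipotent NB).
rewrite mul1r mulr1 addrA [B i j + _]addrC lerDl.
by apply: sumr_ge0 => k _; rewrite mulr_ge0 // nat_points_ge0.
Qed.

Lemma unipotent_le A B : unipotent_group A -> unipotent_group B ->
  (forall i j : 'I_n, (i < j)%N -> A i j <= B i j) -> forall i j, A i j <= B i j.
Proof.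
move=> [A1 A0] [B1 B0] leAB i j.
have [/leAB//|ji|/val_inj ->] := ltngtP i j; last by rewrite A1 B1.
by rewrite A0 // B0.
Qed.

Lemma nat_points_eq1 A : nat_points G A ->
  (forall i j : 'I_n, (i < j)%N -> A i j <= 0) -> A = 1%:M.
Proof.
move=> NA A_le0; have [A1 A0] := nat_points_unipotent NA.
apply/matrixP => i j; rewrite mxE -val_eqE /=.
have [ij|ji|/val_inj ->] := ltngtP i j; last by rewrite A1.
- by apply/eqP; rewrite eq_le A_le0 //= nat_points_ge0.
- by rewrite A0.
Qed.

Lemma Frobenius_set_neq0 S :
  unipotent_numerical_monoid G S -> S <> nat_points G ->
  Frobenius_set G S !=set0.
Proof.
move=> [SN S_mon _ finS] neqSN.
have [_ G_grp _] := G_closed; have [_ NM] := submonoid_nat_points G_grp.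
pose le A B := forall i j, A i j <= B i j.
have [||A [[NA nSA] Amax]] := @finite_set_maximal _ le _ _ finS.
- by move=> B A C leAB leBC i j; apply: le_trans (leAB i j) (leBC i j).
- by apply/set0P/eqP; rewrite setD_eq0 => leNS; apply: neqSN; apply/seteqP.
exists A; split=> // C [] [B [NB B1] <-]; apply: contrapT => nSC; apply: B1 => /=.
- apply: nat_points_eq1 => // i j ij.
  have NAB := NM _ _ NA NB.
  (* [A *m B] is a gap above [A], so maximality gives the reverse inequality; with
     [A i j + B i j <= (A *m B) i j] this forces [B i j <= 0]. *)
  have /(_ i j) : le (A *m B) A.
    apply: Amax => //; apply: unipotent_le; try exact: nat_points_unipotent.
    move=> k l kl; apply: (le_trans _ (mulmx_entry_ge NA NB kl)).
    by rewrite lerDl nat_points_ge0.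
  by move/(le_trans (mulmx_entry_ge NA NB ij)); rewrite gerDl.
- apply: nat_points_eq1 => // i j ij.
  have NBA := NM _ _ NB NA.
  have /(_ i j) : le (B *m A) A.
    apply: Amax => //; apply: unipotent_le; try exact: nat_points_unipotent.
    move=> k l kl; apply: (le_trans _ (mulmx_entry_ge NB NA kl)).
    by rewrite lerDr nat_points_ge0.
  by move/(le_trans (mulmx_entry_ge NB NA ij)); rewrite gerDr.
Qed.

(** Finite generation passes to [T] by adding the finite set [T \ S] to generators of [S]. *)
Lemma numerical_monoid_over S T : unipotent_numerical_monoid G S ->
  S `<=` T -> T `<=` nat_points G -> submonoid T ->
  unipotent_numerical_monoid G T.
Proof.
move=> [_ _ [X [finX SX]] finS] leST TN T_mon; split=> //; last first.
  by apply: sub_finite_set finS; apply: setDS.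
exists (X `|` (T `\` S)); split.
  by rewrite finite_setU; split=> //; apply: sub_finite_set finS; apply: setSD.
apply/seteqP; split=> [A TA|]; last first.
  apply: smallest_sub => // A [XA|[]//]; apply: leST.
  by rewrite SX; apply: sub_gen_smallest.
have [SA|nSA] := pselect (S A); last by apply: sub_gen_smallest; right.
move: SA; rewrite SX => SA M [M_mon leM]; apply: SA; split=> // B XB.
by apply: leM; left.
Qed.

(** Once [T] contains [S], stability under products implies both ideal conditions, and [1%:M] in [T]
    gives the inclusion of [T] in its square. *)
Lemma torsion_idempotentE S (T : set 'M[R[i]]_n) : unipotent_numerical_monoid G S ->
  torsion_idempotent G S T <->
  [/\ S `<=` T, T `<=` nat_points G & submonoid T].
Proof.
move=> [_ [S1 _] _ _]; split=> [[[[TN _ _] leST] TT]|[leST TN [T1 TM]]].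
  split=> //; split; first exact: leST.
  by move=> A B TA TB; rewrite -TT; exists A => //; exists B.
split; first split=> //; first split=> //.
- by move=> _ [A TA [B /leST TB <-]]; apply: TM.
- by move=> _ [A /leST TA [B TB <-]]; apply: TM.
- apply/seteqP; split; first by move=> _ [A TA [B TB <-]]; apply: TM.
  by move=> A TA; exists A => //; exists 1%:M => //; rewrite mulmx1.
Qed.

Lemma minimal_idempotent_sub S T : unipotent_numerical_monoid G S ->
  torsion_idempotent G S T -> T <> S ->
  exists I, minimal_nontrivial_idempotent G S I /\ I `<=` T.
Proof.
move=> S_num T_idem neqTS; have [_ _ _ finS] := S_num.
have [_ TN _] := (torsion_idempotentE T S_num).1 T_idem.
have [||//|I [[I_idem neqIS] leIT Imin]] := cofinite_minimal _ S T
    (fun J => torsion_idempotent G S J /\ J <> S).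
- by move=> J [/(torsion_idempotentE J S_num)[]].
- by apply: sub_finite_set finS; apply: setSD.
- by exists I; split=> //; split=> // J J_idem neqJS; apply: Imin.
Qed.

Lemma submonoidI S T : submonoid S -> submonoid T -> submonoid (S `&` T).
Proof.
move=> [S1 SM] [T1 TM]; split=> // A B [SA TA] [SB TB].
by split; [exact: SM | exact: TM].
Qed.

Lemma irreducible_unique_minimal S :
  unipotent_numerical_monoid G S -> S <> nat_points G ->
  irreducible G S <-> exists! I, minimal_nontrivial_idempotent G S I.
Proof.
move=> S_num neqSN; have [SN S_mon _ _] := S_num.
have [_ G_grp _] := G_closed.
have idemE T := torsion_idempotentE T S_num.
split=> [S_irr|[I [[I_idem neqIS Imin] I_uniq]] [T1 [T2 [T1_num T2_num]]]].
  (* Existence: [nat_points G] is itself a nontrivial idempotent. *)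
  have [|I [I_min _]] := minimal_idempotent_sub S_num (T := nat_points G) _
    (nesym neqSN).
    by apply/idemE; split=> //; apply: submonoid_nat_points.
  exists I; split=> // J J_min.
  have [I_idem neqIS Imin] := I_min; have [J_idem neqJS Jmin] := J_min.
  have [leSI IN I_mon] := (idemE I).1 I_idem.
  have [leSJ JN J_mon] := (idemE J).1 J_idem.
  have IJ_idem : torsion_idempotent G S (I `&` J).
    apply/idemE; split; [by rewrite subsetI | by apply: subIset; left |].
    exact: submonoidI.
  (* If [I] and [J] meet outside [S], both equal their intersection by minimality; otherwise they
     contradict irreducibility. *)
  have [IJS|neqIJS] := pselect (I `&` J = S); last first.
    rewrite -(Imin _ IJ_idem neqIJS (@subIsetl _ I J)).
    exact: Jmin (@subIsetr _ I J).
  case: S_irr; exists I, J.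
  split=> //; try exact: numerical_monoid_over S_num _ _ _;
    by rewrite properEneq; split=> //; apply/eqP; apply: nesym.
(* By uniqueness [I] lies in every numerical monoid strictly above [S], so two of these cannot meet
   in [S]. *)
have over T : unipotent_numerical_monoid G T -> S `<` T -> I `<=` T.
  move=> [TN T_mon _ _]; rewrite properEneq => -[/eqP neqST leST].
  have [|J [J_min leJT]] := minimal_idempotent_sub S_num (T := T) _ (nesym neqST).
    by apply/idemE.
  by rewrite (I_uniq J J_min).
move=> /(over _ T1_num) leIT1 /(over _ T2_num) leIT2 T12S; apply: neqIS.
apply/seteqP; split; first by rewrite -T12S subsetI.
by have [] := (idemE I).1 I_idem.
Qed.

Lemma Frobenius_set_sub_special_gaps S :
  S `<=` nat_points G -> submonoid S -> Frobenius_set G S `<=` special_gaps G S.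
Proof.
move=> SN [S1 _] A [NA nSA SA]; split; last first.
  (* [A] is a gap, hence not the identity, and may serve as its own multiplier. *)
  by apply: SA; left; exists A => //; split=> // A1; apply: nSA; rewrite A1.
by split=> // C [] [B [SB B1] <-]; apply: SA; [left|right]; exists B => //;
  split=> //; apply: SN.
Qed.

Lemma special_gap_monoid S A :
  unipotent_numerical_monoid G S -> special_gaps G S A ->
  unipotent_numerical_monoid G (S `|` [set A]).
Proof.
move=> S_num [[NA nSA SA] SAA]; have [SN [S1 SM] _ _] := S_num.
apply: numerical_monoid_over S_num _ _ _; first by apply: subsetUl.
  by rewrite subUset; split=> // _ ->.
split; first by left.
move=> B C [SB|->] [SC|->]; [left; exact: SM | | | by left].
- have [->|B1] := pselect (B = 1%:M); first by right; rewrite mul1mx.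
  by left; apply: SA; right; exists B.
- have [->|C1] := pselect (C = 1%:M); first by right; rewrite mulmx1.
  by left; apply: SA; left; exists C.
Qed.

(** Adjoining two distinct special gaps separately gives two larger monoids that meet in [S]. *)
Lemma irreducible_special_gaps S A B :
  unipotent_numerical_monoid G S -> irreducible G S ->
  special_gaps G S A -> special_gaps G S B -> A = B.
Proof.
move=> S_num S_irr SA SB; apply: contrapT => neqAB; apply: S_irr.
exists (S `|` [set A]), (S `|` [set B]); split; try exact: special_gap_monoid.
- split; first exact: subsetUl.
  by move=> /(_ A (or_intror erefl)); case: SA => -[].
- split; first exact: subsetUl.
  by move=> /(_ B (or_intror erefl)); case: SB => -[].
- rewrite -setUIr (_ : _ `&` _ = set0) ?setU0 //.
  by apply/seteqP; split=> // C [-> /neqAB].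
Qed.

End Monoids.

Theorem theorem1p6 (R : realType) (n : nat) (n_gt0 : (0 < n)%N)
    (G : set 'M[R[i]]_n)
    (G_closed : closed_unipotent_subgroup G)
    (GN_fg : finitely_generated (nat_points G))
    (GZ_completion : group_completion (nat_points G) (int_points G))
    (S : set 'M[R[i]]_n)
    (S_num : unipotent_numerical_monoid G S)
    (S_proper : S <> nat_points G) :
  irreducible G S <->
  (exists! I, minimal_nontrivial_idempotent G S I) /\
  Frobenius_set G S = special_gaps G S.
Proof.
have irrE := irreducible_unique_minimal G_closed S_num S_proper.
split=> [S_irr|[/irrE]//]; split; first exact/irrE.
have [SN S_mon _ _] := S_num.
have leFSG := Frobenius_set_sub_special_gaps SN S_mon.
apply/seteqP; split=> // A SA.
(* [B] is also a special gap, so the arbitrary special gap [A] coincides with it. *)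
have [B FB] := Frobenius_set_neq0 G_closed S_num S_proper.
by rewrite (irreducible_special_gaps S_num S_irr SA (leFSG _ FB)).
Qed.
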